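(* Suppose the standing assumptions on $f,R,T$ and the inner approximation property stated in the context hold, and that the bounded self-adjoint operators $B_k:W\to W$ satisfy $\|B_k\|\le b_{\max}<\infty$ for all $k$. Let an infinite sequence $(w^k,\Delta_k)_{k\ge0}$ satisfy $w^0\in\operatorname{dom}\varphi$, $0<\Delta_0\le\Delta_{\max}$, $\chi(w^k)>0$ for all $k$, and let it be generated so that, for each $k$, $s_k^{\rm C}$ is produced by the geometric Cauchy search, the trial step $d_k$ satisfies the trial-step condition, and $(w^{k+1},\Delta_{k+1})$ is obtained by the ratio and update rules (all stated in the context; no stopping test is imposed). Then $$\chi(w^k)\longrightarrow0 .$$ Every strong accumulation point of $(w^k)$ is stationary. In finite dimensions (i.e. $\dim W<\infty$), every accumulation point is therefore stationary, and boundedness of the sequence guarantees the existence of at least one such point.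
   Context: $W$ is a real Hilbert space with inner product $(\cdot,\cdot)_W$; $X$ is a real Banach space with continuous dual $X^*$; $T:W\to X$ is bounded and linear with Banach adjoint $T^*:X^*\to W^*$. $\|\ell\|_{W^*}=\|\mathcal R_W^{-1}\ell\|_W$ with $\mathcal R_W:W\to W^*$ the Riesz map. Standing assumptions: $R:X\to(-\infty,+\infty]$ is proper, convex, norm lower semicontinuous; $\varphi=R\circ T$, $\operatorname{dom}\varphi\ne\emptyset$; $f:W\to\mathbb R$ is continuously Fréchet differentiable with Hilbert gradient $\nabla f$ (i.e. $(\nabla f(w),v)_W=f'(w)[v]$) globally Lipschitz with constant $L_f\ge0$; $F=f+\varphi$ is bounded below on $\operatorname{dom}\varphi$ by a finite $F_{\rm low}$. Fixed parameters: $\tau>0$, $0<\sigma<1$, $0<\zeta<1$, $0<\nu\le1$, $0<\eta_1<\eta_2<1$, $0<\gamma_c<1<\gamma_e$, $0<\Delta_{\max}<\infty$. $p(w;t)=\arg\min_{s\in W}\{(\nabla f(w),s)_W+\frac1{2t}\|s\|_W^2+\varphi(w+s)\}$ (unique), and $\chi(w)=\frac1\tau\|p(w;\tau)\|_W$. A point $w\in W$ is stationary if $w\in\operatorname{dom}\varphi$ and $0\in f'(w)+\partial\varphi(w)$ (convex subdifferential in $W^*$). For $q\in W$, $t>0$: $\Psi_{q,t}(y)=\frac1{2t}\|y-q\|_W^2+R(Ty)$, $D_{q,t}(\mu)=\langle\mu,Tq\rangle-\frac t2\|T^*\mu\|_{W^*}^2-R^*(\mu)$, $R^*(\mu)=\sup_{x\in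 X}(\langle\mu,x\rangle-R(x))$, gap $\mathcal G_{q,t}(y,\mu)=\Psi_{q,t}(y)-D_{q,t}(\mu)$, finite when $Ty\in\operatorname{dom}R$, $\mu\in\operatorname{dom}R^*$. Inner approximation property: for every requested $w\in\operatorname{dom}\varphi$ and $t>0$, with $q=w-t\nabla f(w)$, the inner procedure produces a sequence of pairs $(y^j,\mu^j)\in W\times X^*$ with finite gaps and $\mathcal G_{q,t}(y^j,\mu^j)\to0$, together with available numbers $\overline{\mathcal G}_j\ge\mathcal G_{q,t}(y^j,\mu^j)$, $\overline{\mathcal G}_j\to0$, used in all tests ($\overline{\mathcal G}_j$ is either the gap itself or a rigorous upper bound for it). The pair $(s,\mu)=(y^j-w,\mu^j)$ passes the relative test at $(w,t)$ if $\overline{\mathcal G}_j\le\frac{\sigma^2}{2t}\|s\|_W^2$. Model: $m_k(s)=f(w^k)+(\nabla f(w^k),s)_W+\frac12(B_ks,s)_W+\varphi(w^k+s)$, $\operatorname{pred}_k(s)=m_k(0)-m_k(s)$. Geometric Cauchy search: set $\bar t_k=\min\{\tau,(1-\sigma)/(1+\|B_k\|)\}$. For $j=0,1,\dots$ let $t_{k,j}=\zeta^j\bar t_k$, and run the inner procedure at $(w^k,t_{k,j})$ until a pair $(s_{k,j},\mu_{k,j})$ passes the relative test at $(w^k,t_{k,j})$. Return $s_k^{\rm C}=s_{k,j}$ for the first $j$ with $\|s_{k,j}\|_W\le\Delta_k$. Trial-step condition: $\|d_k\|_W\le\Delta_k$, $w^k+d_k\in\operatorname{dom}\varphi$, $\operatorname{pred}_k(d_k)\ge\nu\operatorname{pred}_k(s_k^{\rm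 C})$. Ratio and update rules: $\rho_k=[F(w^k)-F(w^k+d_k)]/\operatorname{pred}_k(d_k)$. If $\rho_k<\eta_1$: $w^{k+1}=w^k$, $\Delta_{k+1}=\gamma_c\Delta_k$. If $\eta_1\le\rho_k<\eta_2$: $w^{k+1}=w^k+d_k$, $\Delta_{k+1}=\Delta_k$. If $\rho_k\ge\eta_2$: $w^{k+1}=w^k+d_k$, $\Delta_{k+1}=\min\{\gamma_e\Delta_k,\Delta_{\max}\}$. *)

(* Defs.v *)
From HB Require Import structures.
From mathcomp Require Import all_boot all_order all_algebra.
From mathcomp Require Import all_classical all_reals all_analysis.

Set Implicit Arguments.
Unset Strict Implicit.
Unset Printing Implicit Defensive.

Import Order.TTheory GRing.Theory Num.Theory.
Import numFieldNormedType.Exports.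

Local Open Scope classical_set_scope.
Local Open Scope ring_scope.

Section NormedSpaces.
Context {R : realType}.

(* [opnorm A] is the operator norm only when [A] is bounded: [sup] is a junk
   value on unbounded sets. *)
Definition opnorm {V U : normedModType R} (A : V -> U) : R :=
  sup [set `|A x| | x in [set x : V | `|x| <= 1]].

Definition finite_dimensional (V : lmodType R) : Prop :=
  exists (n : nat) (e : 'I_n -> V),
    forall v, exists c : 'I_n -> R, v = \sum_(i < n) c i *: e i.

(* The continuous dual V^*, as a set of linear forms. *)
Definition topdual (V : normedModType R) : set {linear V -> R^o} :=
  [set l | continuous l].

End NormedSpaces.

Section ConvexAnalysis.
Context {R : realType}.
Local Open Scope ereal_scope.

Definition dom {T : Type} (g : T -> \bar R) : set T := [set x | g x < +oo].

Definition proper_function {T : Type} (g : T -> \bar R) : Prop :=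
  (forall x, -oo < g x) /\ dom g !=set0.

(* The library's [convex_function] only covers real-valued functions. *)
Definition econvex {V : lmodType R} (g : V -> \bar R) : Prop :=
  forall (x y : V) (a : R), (0 < a < 1)%R ->
    g (a *: x + (1 - a) *: y)%R <= a%:E * g x + (1 - a)%:E * g y.

Definition conjugate {V : normedModType R} (g : V -> \bar R)
    (mu : {linear V -> R^o}) : \bar R :=
  ereal_sup [set (mu x)%:E - g x | x in setT].

Definition subdifferential {V : normedModType R} (g : V -> \bar R) (w : V) :
    set {linear V -> R^o} :=
  [set xi | [/\ topdual xi, dom g w &
    forall v, g w + (xi (v - w))%:E <= g v]].

End ConvexAnalysis.

Section Hilbert.
Context {R : realType} {W : completeNormedModType R}.
Variable ip : {dot W for idfun}.

(* With the completeness of [W], this makes ([W], [ip]) a real Hilbert space. *)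
Definition norm_of_dot : Prop := forall w : W, ip w w = `|w| ^+ 2.

(* The inverse of the Riesz map w |-> (w, .)_W, on the continuous linear
   forms. *)
Definition riesz_inv (l : W -> R) : W :=
  get [set r : W | forall v, ip r v = l v].

Definition dual_norm (l : W -> R) : R := `|riesz_inv l|.

Definition grad (f : W -> R^o) (w : W) : W := riesz_inv ('d f w).

Definition continuously_frechet_differentiable (f : W -> R^o) : Prop :=
  (forall w, differentiable f w) /\
  (forall w, dual_norm (fun v => 'd f u v - 'd f w v) @[u --> w] --> (0 : R)).

Definition self_adjoint (B : W -> W) : Prop :=
  forall u v, ip (B u) v = ip u (B v).

Definition stationary (f : W -> R^o) (phi : W -> \bar R) (w : W) : Prop :=
  dom phi w /\
  exists2 xi, subdifferential phi w xi & forall v, 'd f w v + xi v = 0.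

Definition prox_objective (f : W -> R^o) (phi : W -> \bar R) (w : W) (t : R)
    (s : W) : \bar R :=
  ((ip (grad f w) s + (2 * t)^-1 * `|s| ^+ 2)%:E + phi (w + s)%R)%E.

Definition prox_step (f : W -> R^o) (phi : W -> \bar R) (w : W) (t : R) : W :=
  get [set s | forall s' : W,
    (prox_objective f phi w t s <= prox_objective f phi w t s')%E].

Definition chi (f : W -> R^o) (phi : W -> \bar R) (tau : R) (w : W) : R :=
  tau^-1 * `|prox_step f phi w tau|.

Definition model (f : W -> R^o) (phi : W -> \bar R) (B : W -> W) (w s : W) :
    \bar R :=
  ((f w + ip (grad f w) s + 2^-1 * ip (B s) s)%:E + phi (w + s)%R)%E.

Definition predicted (f : W -> R^o) (phi : W -> \bar R) (B : W -> W)
    (w s : W) : \bar R :=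
  (model f phi B w 0%R - model f phi B w s)%E.

Definition objective (f : W -> R^o) (phi : W -> \bar R) (w : W) : \bar R :=
  ((f w)%:E + phi w)%E.

(* All the quantities involved are finite when [w] and [w + d] are in
   [dom phi]. *)
Definition reduction_ratio (f : W -> R^o) (phi : W -> \bar R) (B : W -> W) (w d : W) :
    R :=
  fine (objective f phi w - objective f phi (w + d)%R)%E
  / fine (predicted f phi B w d).

End Hilbert.

Section InnerProcedure.
Context {R : realType} {W X : completeNormedModType R}.
Variables (ip : {dot W for idfun}) (T : {linear W -> X}) (r : X -> \bar R).

Definition primal_value (q : W) (t : R) (y : W) : \bar R :=
  (((2 * t)^-1 * `|y - q| ^+ 2)%:E + r (T y))%E.

(* T^* mu is mu \o T. *)
Definition dual_value (q : W) (t : R) (mu : {linear X -> R^o}) : \bar R :=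
  ((mu (T q) - t / 2 * dual_norm ip (mu \o T) ^+ 2)%:E - conjugate r mu)%E.

Definition gap (q : W) (t : R) (y : W) (mu : {linear X -> R^o}) : \bar R :=
  (primal_value q t y - dual_value q t mu)%E.

Record inner_run := InnerRun {
  run_y : nat -> W ;
  run_mu : nat -> {linear X -> R^o} ;
  run_gap : nat -> R (* the available upper bounds of the gaps *) }.

Definition valid_run (q : W) (t : R) (rn : inner_run) : Prop :=
  [/\ forall i, topdual (run_mu rn i),
      forall i, gap q t (run_y rn i) (run_mu rn i) \is a fin_num,
      gap q t (run_y rn i) (run_mu rn i) @[i --> \oo] --> (0%E : \bar R),
      forall i, (gap q t (run_y rn i) (run_mu rn i) <= (run_gap rn i)%:E)%E
    & run_gap rn i @[i --> \oo] --> (0 : R)].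

(* [inner w t] is the set of the possible runs of the inner procedure requested
   at (w, t): two requests at the same (w, t) need not produce the same run. *)
Definition inner_approximation (f : W -> R^o)
    (inner : W -> R -> set inner_run) : Prop :=
  forall (w : W) (t : R), dom (r \o T) w -> 0 < t ->
    inner w t !=set0 /\
    forall rn, inner w t rn -> valid_run (w - t *: grad ip f w) t rn.

Definition run_step (w : W) (rn : inner_run) (i : nat) : W := run_y rn i - w.

Definition relative_test (sigma : R) (w : W) (t : R) (rn : inner_run)
    (i : nat) : Prop :=
  run_gap rn i <= sigma ^+ 2 / (2 * t) * `|run_step w rn i| ^+ 2.

Definition first_passing (sigma : R) (w : W) (t : R) (rn : inner_run)
    (i : nat) : Prop :=
  relative_test sigma w t rn i /\
  forall i', (i' < i)%N -> ~ relative_test sigma w t rn i'.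

Definition cauchy_t0 (tau sigma : R) (B : W -> W) : R :=
  Num.min tau ((1 - sigma) / (1 + opnorm B)).

Definition cauchy_t (tau sigma zeta : R) (B : W -> W) (j : nat) : R :=
  zeta ^+ j * cauchy_t0 tau sigma B.

Definition cauchy_search (inner : W -> R -> set inner_run)
    (tau sigma zeta : R) (B : W -> W) (w : W) (Delta : R) (sC : W) : Prop :=
  exists (jC : nat) (rn : nat -> inner_run) (i : nat -> nat),
  let t := cauchy_t tau sigma zeta B in
  let s j := run_step w (rn j) (i j) in
  [/\ forall j, (j <= jC)%N ->
        inner w (t j) (rn j) /\ first_passing sigma w (t j) (rn j) (i j),
      forall j, (j < jC)%N -> Delta < `|s j|,
      `|s jC| <= Delta
    & sC = s jC].

End InnerProcedure.

Arguments inner_run {R} W X.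

Section TrustRegion.
Context {R : realType} {W : completeNormedModType R}.
Variables (ip : {dot W for idfun}) (f : W -> R^o) (phi : W -> \bar R).

Definition trial_step (nu : R) (B : W -> W) (w : W) (Delta : R) (sC d : W) :
    Prop :=
  [/\ `|d| <= Delta, dom phi (w + d) &
      (nu%:E * predicted ip f phi B w sC <= predicted ip f phi B w d)%E].

Definition update (eta1 eta2 gammac gammae Dmax : R) (B : W -> W)
    (w d : W) (Delta : R) (w' : W) (Delta' : R) : Prop :=
  let rho := reduction_ratio ip f phi B w d in
  [/\ rho < eta1 -> w' = w /\ Delta' = gammac * Delta,
      eta1 <= rho < eta2 -> w' = w + d /\ Delta' = Delta
    & eta2 <= rho -> w' = w + d /\ Delta' = Num.min (gammae * Delta) Dmax].

End TrustRegion.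

(* Main.v *)
Require Import Defs.
From HB Require Import structures.
From mathcomp Require Import all_boot all_order all_algebra.
From mathcomp Require Import all_classical all_reals all_analysis.
From mathcomp Require Import ring lra.

Set Implicit Arguments.
Unset Strict Implicit.
Unset Printing Implicit Defensive.

Import Order.TTheory GRing.Theory Num.Theory.
Import numFieldNormedType.Exports.

Local Open Scope classical_set_scope.
Local Open Scope ring_scope.

(** The proof rests on one description of proximal points.  A point z is the
    minimizer of phi + |. - q|^2 / (2t) exactly when the variational inequality
    [prox_point] holds; nonexpansiveness, the monotonicity of the residual |p|/t
    in t, quadratic growth and passage to the limit all follow from it by adding
    two instances or by letting the data converge.

    Existence of proximal points needs a lower bound for the objective, and this
    bound comes from the inner procedure itself: a pair with finite gap gives a
    finite dual value, which by weak duality ([gap_suboptimality]) bounds the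
    primal objective below.  Minimizing sequences are then Cauchy by strong
    convexity ([prox_point_exists]).  The Riesz theorem, which makes the
    gradient and the dual norm meaningful, is the special case of a linear phi.

    Weak duality also shows that the gap dominates the primal suboptimality, so
    the relative test forces the computed step s to lie within sigma |s| of the
    exact proximal step p ([inexact_step_error]).  Hence |s| and |p| are
    comparable, and the step s decreases the linearized objective by at least
    (1 - sigma)/t |s|^2, half of which survives the curvature term since
    t <= (1 - sigma)/(1 + |B|).  As |p|/t dominates chi for t <= tau, and a
    rejected length t/zeta gave a step longer than Delta, the Cauchy step yields
    a model decrease of at least kappa chi min(chi, Delta)
    ([cauchy_search_decrease]).

    From there on, only real sequences matter ([criticality_cvg0]): accepted
    steps decrease F by a multiple of chi min(chi, Delta), steps with Delta small
    against chi are accepted, and chi is Lipschitz, because the proximal map is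
    nonexpansive and the gradient Lipschitz.  If chi stayed above e, the radius
    would stay bounded below and F would decrease without bound.  And chi cannot
    stay large infinitely often: while it is above e, the path length is
    controlled by the decrease of F, which tends to 0, so chi hardly changes
    before it falls below e.

    At an accumulation point, the variational inequality of the proximal points
    passes to the limit, by closedness of the sublevel sets of phi, and becomes
    the stationarity condition.  In finite dimension a Parseval frame supplies
    coordinates that are bounded along the sequence, hence convergent along an
    ultrafilter. *)

(** * Inner products *)

Section InnerProduct.
Context {R : realType} {W : completeNormedModType R}.
Variable ip : {dot W for idfun}.
Hypothesis hip : norm_of_dot ip.

Lemma ipC u v : ip u v = ip v u.
Proof. by rewrite (hermC ip) expr0 mul1r. Qed.

Lemma ipDl u v x : ip (u + v) x = ip u x + ip v x.
Proof. exact: linearDl. Qed.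

Lemma ipNl u x : ip (- u) x = - ip u x.
Proof. exact: linearNl. Qed.

Lemma ipZl a u x : ip (a *: u) x = a * ip u x.
Proof. by rewrite linearZl_LR. Qed.

Lemma ipDr u v x : ip x (u + v) = ip x u + ip x v.
Proof. by rewrite ipC ipDl !(ipC x). Qed.

Lemma ipNr u x : ip x (- u) = - ip x u.
Proof. by rewrite ipC ipNl ipC. Qed.

Lemma ipZr a u x : ip x (a *: u) = a * ip x u.
Proof. by rewrite ipC ipZl ipC. Qed.

Lemma ip0r x : ip x 0 = 0.
Proof. by rewrite -(scale0r (0 : W)) ipZr mul0r. Qed.

Definition ipE := (ipDl, ipDr, ipNl, ipNr, ipZl, ipZr).

Lemma sqnormD u v : `|u + v| ^+ 2 = `|u| ^+ 2 + 2 * ip u v + `|v| ^+ 2.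
Proof. by rewrite -!hip !ipE (ipC v u); ring. Qed.

Lemma sqnormB u v : `|u - v| ^+ 2 = `|u| ^+ 2 - 2 * ip u v + `|v| ^+ 2.
Proof. by rewrite sqnormD normrN ipNr; ring. Qed.

Lemma sqnormZ a (u : W) : `|a *: u| ^+ 2 = a ^+ 2 * `|u| ^+ 2.
Proof. by rewrite normrZ exprMn real_normK ?num_real. Qed.

Lemma cauchy_schwarz u v : `|ip u v| <= `|u| * `|v|.
Proof.
have [->|v0] := eqVneq v 0; first by rewrite ip0r !normr0 mulr0.
have vp : 0 < `|v| by rewrite normr_gt0.
rewrite -(@ler_pXn2r _ 2) ?nnegrE ?mulr_ge0// exprMn real_normK ?num_real//.
have : 0 <= `| `|v| ^+ 2 *: u - ip u v *: v| ^+ 2 by rewrite exprn_ge0.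
rewrite sqnormB !sqnormZ ipZl ipZr.
have v2 : 0 < `|v| ^+ 2 by rewrite exprn_gt0.
set V := `|v| ^+ 2 in v2 *; set U := `|u| ^+ 2; set p := ip u v => h.
rewrite -(ler_pM2l v2); lra.
Qed.

Lemma ip_le u v : ip u v <= `|u| * `|v|.
Proof. exact: le_trans (ler_norm _) (cauchy_schwarz u v). Qed.

Lemma cvg_ip (T : Type) (F : set_system T) (FF : Filter F) (a b : T -> W) x y :
  a i @[i --> F] --> x -> b i @[i --> F] --> y ->
  ip (a i) (b i) @[i --> F] --> ip x y.
Proof.
move=> ax bx.
have pol u v : ip u v = 4^-1 * (`|u + v| ^+ 2 - `|u - v| ^+ 2).
  by rewrite sqnormD sqnormB; field.
rewrite (funext (fun i => pol (a i) (b i))) pol.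
apply: cvgM; first exact: cvg_cst.
by apply: cvgB; rewrite !expr2; apply: cvgM; apply: cvg_norm;
  [apply: cvgD|apply: cvgD|apply: cvgB|apply: cvgB].
Qed.

End InnerProduct.

(** * Proximal points of convex functions *)

Section ProximalPoint.
Context {R : realType} {W : completeNormedModType R}.
Variable ip : {dot W for idfun}.
Hypothesis hip : norm_of_dot ip.

(** The optimality condition of the problem of minimizing
    phi + |. - q|^2 / (2t), in a form that involves only real numbers. *)
Definition prox_point (phi : W -> \bar R) (q : W) (t : R) (z : W) : Prop :=
  dom phi z /\ forall v, dom phi v ->
    fine (phi z) + t^-1 * ip (q - z) (v - z) <= fine (phi v).

Section Properties.
Variables (phi : W -> \bar R).
Hypothesis phi_gt : forall x, (-oo < phi x)%E.

Lemma fin_num_dom x : dom phi x -> phi x \is a fin_num.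
Proof. by move=> dx; rewrite fin_numElt phi_gt dx. Qed.

Lemma dom_fineK x : dom phi x -> (fine (phi x))%:E = phi x.
Proof. by move=> dx; rewrite fineK// fin_num_dom. Qed.

Lemma notin_dom x : ~ dom phi x -> phi x = +oo%E.
Proof. by move=> ndx; apply/eqP; rewrite -leye_eq leNgt; apply/negP. Qed.

Lemma dom_le x (c : R) : (phi x <= c%:E)%E -> dom phi x /\ fine (phi x) <= c.
Proof.
move=> xc; have dx : dom phi x by apply: le_lt_trans xc (ltry _).
by split=> //; rewrite -lee_fin dom_fineK.
Qed.

Lemma econvex_fine x y a : econvex phi -> dom phi x -> dom phi y -> 0 < a < 1 ->
  dom phi (a *: x + (1 - a) *: y) /\
  fine (phi (a *: x + (1 - a) *: y)) <= a * fine (phi x) + (1 - a) * fine (phi y).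
Proof.
move=> cphi dx dy a01; apply: dom_le.
by rewrite EFinD !EFinM !dom_fineK//; apply: cphi.
Qed.

(** Expanding |v - q|^2 around z turns the variational inequality into the
    quadratic growth of the strongly convex objective at its minimizer. *)
Lemma prox_point_gap q t z v : 0 < t -> prox_point phi q t z -> dom phi v ->
  fine (phi z) + (2 * t)^-1 * `|z - q| ^+ 2 + (2 * t)^-1 * `|v - z| ^+ 2
    <= fine (phi v) + (2 * t)^-1 * `|v - q| ^+ 2.
Proof.
move=> t0 [_ /(_ v)] h /h{h}.
have -> : v - q = (v - z) - (q - z) by rewrite opprB addrA subrK.
rewrite (sqnormB hip (v - z)) (distrC z q) (ipC _ (v - z)) invfM.
by move=> h; lra.
Qed.

Hypothesis phi_convex : econvex phi.
Hypothesis phi_closed : forall c : R, closed [set x | (phi x <= c%:E)%E].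

(** Strong convexity, applied at midpoints, makes every minimizing sequence
    Cauchy; closedness of the sublevel sets makes its limit a minimizer.
    Comparing the minimizer z with a v + (1 - a) z and letting a tend to 0 gives
    the variational inequality. *)
Lemma prox_point_exists (q : W) (t m : R) : 0 < t -> dom phi !=set0 ->
  (forall v, dom phi v -> m <= fine (phi v) + (2 * t)^-1 * `|v - q| ^+ 2) ->
  exists z, prox_point phi q t z.
Proof.
move=> t0 [x0 dx0] hm.
set c := (2 * t)^-1.
have c0 : 0 < c by rewrite invr_gt0 mulr_gt0.
pose H v := fine (phi v) + c * `|v - q| ^+ 2.
pose I := inf [set H v | v in dom phi].
have lbH : lbound [set H v | v in dom phi] m by move=> _ [v dv <-]; exact: hm.
have IH v : dom phi v -> I <= H v.
  by move=> dv; apply: ge_inf; [exists m|exists v].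
have infH : has_inf [set H v | v in dom phi].
  by split; [exists (H x0), x0|exists m].
have /choice[y hy] : forall n, exists v, dom phi v /\ H v < I + n.+1%:R^-1.
  move=> n; have n0 : 0 < n.+1%:R^-1 :> R by rewrite invr_gt0 ltr0n.
  by have [_ [v dv <-] ?] := inf_adherent n0 infH; exists v.
(* The midpoint of u and v is worth at least I. *)
have mid u v : dom phi u -> dom phi v ->
    c / 4 * `|u - v| ^+ 2 <= 2^-1 * H u + 2^-1 * H v - I.
  move=> du dv.
  have h2 : 0 < (2^-1 : R) < 1 by lra.
  have [dm hle] := econvex_fine phi_convex du dv h2.
  have := IH _ dm; rewrite /H.
  have -> : 2^-1 *: u + (1 - 2^-1) *: v - q
      = 2^-1 *: (u - q) + (1 - 2^-1) *: (v - q).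
    rewrite !scalerBr addrACA -opprD -scalerDl; congr (_ - _).
    by rewrite addrC subrK scale1r.
  have -> : u - v = (u - q) - (v - q) by rewrite opprB addrA subrK.
  rewrite (sqnormD hip) (sqnormB hip (u - q) (v - q)) !sqnormZ !ipE.
  by move: hle => /[swap]; lra.
have cy : cvg (y @ \oo).
  apply: cauchy_cvg; apply: cauchy_exP => e e0.
  have k0 : 0 < c / 4 * e ^+ 2 by rewrite !mulr_gt0 ?exprn_gt0// invr_gt0.
  have [N _ HN] : \forall n \near \oo, n.+1%:R^-1 < c / 4 * e ^+ 2.
    exact: near_infty_natSinv_lt (PosNum k0).
  exists (y N); exists N => // n /= Nn.
  rewrite -ball_normE /=.
  have c4 : 0 < c / 4 by lra.
  rewrite -(@ltr_pXn2r _ 2) ?nnegrE ?(ltW e0)// -(ltr_pM2l c4).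
  apply: le_lt_trans (mid _ _ (proj1 (hy N)) (proj1 (hy n))) _.
  have := proj2 (hy N); have := proj2 (hy n).
  have := HN N (leqnn _); have := HN n Nn => /=.
  by move: (n.+1%:R^-1) (N.+1%:R^-1) (c / 4 * _) => a b d; lra.
have [z yz] : exists z : W, y @ \oo --> z by exists (lim (y @ \oo)).
pose L := I - c * `|z - q| ^+ 2.
have uL : (I + n.+1%:R^-1 - c * `|y n - q| ^+ 2) @[n --> \oo] --> L.
  apply: cvgB; last first.
    apply: cvgM; first exact: cvg_cst.
    rewrite !expr2; apply: cvgM; apply: cvg_norm.
      by apply: cvgB => //; exact: cvg_cst.
    by apply: cvgB => //; exact: cvg_cst.
  rewrite -[X in _ --> X]addr0; apply: cvgD; first exact: cvg_cst.
  exact: cvg_harmonic.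
have zL : (phi z <= L%:E)%E.
  apply/lee_addgt0Pr => e e0; rewrite -EFinD.
  apply: (closed_cvg _ (@phi_closed (L + e)) _ z yz).
  have Le : L < L + e by lra.
  near=> n => /=; rewrite -dom_fineK ?lee_fin; last exact: (proj1 (hy n)).
  have h1 : I + n.+1%:R^-1 - c * `|y n - q| ^+ 2 < L + e.
    by near: n; exact: (cvgr_lt L uL _ Le).
  have := proj2 (hy n); rewrite /H.
  by move: (n.+1%:R^-1) h1 => a; lra.
have [dz hz] := dom_le zL.
exists z; split=> // v dv.
(* Minimality of z at the point a v + (1 - a) z, divided by a. *)
have key a : 0 < a < 1 ->
    0 <= fine (phi v) - fine (phi z) - t^-1 * ip (q - z) (v - z)
         + a * (c * `|v - z| ^+ 2).
  move=> a01; have [da hle] := econvex_fine phi_convex dv dz a01.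
  have := IH _ da; rewrite /H.
  have -> : a *: v + (1 - a) *: z - q = a *: (v - z) - (q - z).
    rewrite scalerBr scalerBl scale1r opprB [RHS]addrA; congr (_ - _).
    by rewrite addrA addrAC.
  rewrite (sqnormB hip) sqnormZ !ipZl (ipC _ (v - z)) (distrC q z).
  have a0 : 0 < a by lra.
  have tE : t^-1 = 2 * c by rewrite /c invfM mulrA divff ?mul1r.
  rewrite tE => h; rewrite -(pmulr_rge0 _ a0).
  by move: hz; rewrite /L => hz; lra.
rewrite -subr_ge0 opprD addrA.
set X := (X in 0 <= X) in key *.
apply/ler_addgt0Pr => e e0.
(* It remains to let a tend to 0: the value chosen makes a Y <= e. *)
pose Y := c * `|v - z| ^+ 2.
have Y0 : 0 <= Y by rewrite mulr_ge0 ?exprn_ge0// ltW.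
pose a := Num.min 2^-1 (e / (Y + 1)).
have a01 : 0 < a < 1.
  rewrite lt_min invr_gt0 ltr0n divr_gt0 ?ltr_wpDl//= gt_min.
  by apply/orP; left; lra.
have := key a a01; rewrite -/Y -/X => h; apply: le_trans h _.
rewrite lerD2l; apply: le_trans (_ : e / (Y + 1) * Y <= _).
  by rewrite ler_wpM2r// ge_min lexx orbT.
by rewrite mulrAC ler_pdivrMr ?ltr_wpDl// ler_pM2l//; lra.
Unshelve. all: by end_near. Qed.

End Properties.
End ProximalPoint.

(** * Riesz representation and gradients *)

Section Riesz.
Context {R : realType} {W : completeNormedModType R}.
Variable ip : {dot W for idfun}.
Hypothesis hip : norm_of_dot ip.

(** The proximal point of -l at 0 with t = 1 minimizes |v|^2 / 2 - l v; its
    variational inequality reads l z <= (r, z), and applied to z and - z it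
    gives equality. *)
Lemma riesz_representation (l : {linear W -> R^o}) : continuous l ->
  exists r, forall v, ip r v = l v.
Proof.
move=> lc; pose phi (v : W) : \bar R := (- l v)%:E.
have dphi v : dom phi v by exact: ltry.
have [C C0 lC] : exists2 C, 0 < C & forall v, `|l v| <= C * `|v|.
  have /linear_boundedP/pinfty_ex_gt0[C C0 hC] :=
    proj2 (linear_bounded_continuous l) lc.
  by exists C.
have [|x y a _|c||v _|r [_ hr]] :=
    @prox_point_exists _ _ ip hip phi _ _ _ 0 1 (- (C ^+ 2 / 2)) ltr01.
- by move=> x; exact: ltNyr.
- have lE : l (a *: x + (1 - a) *: y) = a * l x + (1 - a) * l y.
    by rewrite linearD !linearZ.
  by rewrite /phi lE -!EFinM -EFinD lee_fin; lra.
- rewrite (_ : mkset _ = l @^-1` [set y : R | - c <= y]).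
    by apply: closed_comp; [move=> x _; exact: lc|exact: closed_ge].
  by apply/seteqP; split=> x /=; rewrite /phi lee_fin lerNl.
- by exists 0.
- rewrite subr0 mulr1 /=; have := lC v; have := ler_norm (l v).
  have : 0 <= (`|v| - C) ^+ 2 by exact: sqr_ge0.
  by rewrite sqrrB; lra.
have rE z : l z <= ip r z.
  have := hr (r + z) (dphi _).
  rewrite /= invr1 mul1r sub0r (addrC r) addrK (ipNl ip) linearD/=.
  by lra.
exists r => v; apply/eqP; rewrite eq_le rE andbT.
by have := rE (- v); rewrite (ipNr ip) linearN lerN2.
Qed.

Lemma riesz_invE (l : {linear W -> R^o}) v : continuous l ->
  ip (riesz_inv ip l) v = l v.
Proof.
by move=> /riesz_representation/getPex; exact.
Qed.

Section Gradient.
Variables (f : W -> R^o).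
Hypothesis f_diff : forall w, differentiable f w.

Lemma gradE w v : ip (grad ip f w) v = 'd f w v.
Proof. by rewrite riesz_invE//; exact: diff_continuous. Qed.

(** The difference quotients of s |-> f (w + s d) are those of f in the
    direction d, so that the one-variable mean value theorem applies. *)
Lemma mean_value w d : exists2 s : R, 0 <= s <= 1 &
  f (w + d) - f w = ip (grad ip f (w + s *: d)) d.
Proof.
pose g (s : R) : R := f (w + s *: d).
have der s : is_derive s (1 : R) g (ip (grad ip f (w + s *: d)) d).
  have qE : (fun h : R => h^-1 *: ((g \o shift s) (h *: (1 : R)) - g s))
      = (fun h : R => h^-1 *: ((f \o shift (w + s *: d)) (h *: d) - f (w + s *: d))).
    apply/funext => h; rewrite /g /= /shift; congr (_ *: (f _ - _)).
    by rewrite [h *: (1 : R)]mulr1 scalerDl addrCA.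
  have fd : derivable f (w + s *: d) d by exact: diff_derivable.
  split; first by rewrite /derivable qE.
  by rewrite gradE -deriveE// /derive qE.
have [|s s01] := @MVT_segment R g _ 0 1 ler01 (fun s _ => der s).
  apply: derivable_within_continuous => s _.
  by have [] := der s.
rewrite /g subr0 mulr1 scale1r scale0r addr0 => hs.
by exists s; first by move: s01; rewrite in_itv.
Qed.

(** The mean value theorem loses the factor 1/2 of the descent lemma; only the
    order |d|^2 matters below. *)
Lemma linearization_error (L : R) w d : 0 <= L -> L.-lipschitz (grad ip f) ->
  `|f (w + d) - f w - ip (grad ip f w) d| <= L * `|d| ^+ 2.
Proof.
move=> L0 lip; have [s s01 ->] := mean_value w d.
rewrite -(ipNl ip) -(ipDl ip); apply: le_trans (cauchy_schwarz hip _ _) _.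
rewrite expr2 mulrA ler_wpM2r//.
have /= := lip (w + s *: d, w) (conj I I).
move=> /le_trans; apply; rewrite addrC addKr normrZ ger0_norm; last by lra.
by rewrite ler_wpM2l// ler_piMl//; lra.
Qed.

End Gradient.
End Riesz.

(** * Stability of proximal points *)

Section ProximalStep.
Context {R : realType} {W : completeNormedModType R}.
Variable ip : {dot W for idfun}.
Hypothesis hip : norm_of_dot ip.
Variables (phi : W -> \bar R).

Lemma prox_point_nonexpansive q q' t z z' : 0 < t ->
  prox_point ip phi q t z -> prox_point ip phi q' t z' ->
  `|z' - z| <= `|q' - q|.
Proof.
move=> t0 [dz hz] [dz' hz'].
have := hz _ dz'; have := hz' _ dz.
have -> : ip (q' - z') (z - z') = ip (z' - q') (z' - z).
  by rewrite -opprB -(opprB z' z) (ipNl ip) (ipNr ip) opprK.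
move=> h1 h2.
have {h1 h2} : t^-1 * (ip (z' - q') (z' - z) + ip (q - z) (z' - z)) <= 0 by lra.
rewrite pmulr_rle0 ?invr_gt0// -(ipDl ip).
have -> : z' - q' + (q - z) = (z' - z) - (q' - q).
  by rewrite addrACA opprB [RHS]addrACA (addrC (- z)) addrA -addrA (addrC (- q')).
rewrite (ipDl ip) (ipNl ip) hip => h.
have [->|zz] := eqVneq (z' - z) 0; first by rewrite normr0.
have n0 : 0 < `|z' - z| by rewrite normr_gt0.
rewrite -(ler_pM2r n0); have := ip_le hip (q' - q) (z' - z).
by rewrite expr2 in h; lra.
Qed.

(** The two variational inequalities add up to
    (u' - u, t' u' - t u) <= 0 for u = p/t and u' = p'/t', and by Cauchy-Schwarz
    the left-hand side is at least (t' |u'| - t |u|) (|u'| - |u|). *)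
Lemma prox_residual_nonincreasing w g t t' p p' : 0 < t -> t <= t' ->
  prox_point ip phi (w - t *: g) t (w + p) ->
  prox_point ip phi (w - t' *: g) t' (w + p') ->
  t'^-1 * `|p'| <= t^-1 * `|p|.
Proof.
move=> t0 tt' [dp hp] [dp' hp']; have t'0 : 0 < t' by apply: lt_le_trans tt'.
have sE s x : w - s *: g - (w + x) = - (s *: g) - x.
  by rewrite opprD addrACA subrr add0r.
have dE x y : w + x - (w + y) = x - y by rewrite opprD addrACA subrr add0r.
have := hp _ dp'; have := hp' _ dp; rewrite !sE !dE.
rewrite !(ipE ip) (ipC ip p' p).
have tV : t^-1 * t = 1 by rewrite mulVf ?gt_eqF.
have t'V : t'^-1 * t' = 1 by rewrite mulVf ?gt_eqF.
set P := ip p p; set P' := ip p' p'; set Q := ip p p'.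
set G := ip g p; set G' := ip g p'.
rewrite !mulrDr !mulrN !mulrA !opprK !tV !t'V !mul1r => h1 h2.
have QN : Q <= `|p| * `|p'| by exact: ip_le.
have PE : P = `|p| ^+ 2 by exact: hip.
have P'E : P' = `|p'| ^+ 2 by exact: hip.
rewrite leNgt; apply/negP => lt.
pose a := t^-1 * `|p|; pose b := t'^-1 * `|p'|.
have pa : `|p| = t * a by rewrite /a mulVKf ?gt_eqF.
have pb : `|p'| = t' * b by rewrite /b mulVKf ?gt_eqF.
have a0 : 0 <= a by rewrite mulr_ge0// invr_ge0 ltW.
have ab : a < b by [].
have tQ : t^-1 * Q <= a * (t' * b).
  by rewrite /a -pb -mulrA ler_wpM2l// invr_ge0 ltW.
have t'Q : t'^-1 * Q <= b * (t * a).
  by rewrite /b -pa -mulrA (mulrC `|p'|) ler_wpM2l// invr_ge0 ltW.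
have tP : t^-1 * P = t * a ^+ 2.
  by rewrite PE pa exprMn expr2 !mulrA tV mul1r.
have t'P : t'^-1 * P' = t' * b ^+ 2.
  by rewrite P'E pb exprMn expr2 !mulrA t'V mul1r.
have : (t' * b - t * a) * (b - a) <= 0 by rewrite expr2 in tP t'P; lra.
apply/negP; rewrite -ltNge mulr_gt0 ?subr_gt0//.
apply: le_lt_trans (_ : t' * a < _); first by rewrite ler_wpM2r.
by rewrite ltr_pM2l.
Qed.

Hypothesis phi_gt : forall x, (-oo < phi x)%E.

Lemma prox_objectiveE f w t s : 0 < t -> dom phi (w + s) ->
  prox_objective ip f phi w t s =
    (fine (phi (w + s)) + (2 * t)^-1 * `|w + s - (w - t *: grad ip f w)| ^+ 2
     - t / 2 * `|grad ip f w| ^+ 2)%:E.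
Proof.
move=> t0 ds; rewrite /prox_objective -(dom_fineK phi_gt ds) -EFinD; congr EFin.
have -> : w + s - (w - t *: grad ip f w) = s + t *: grad ip f w.
  by rewrite opprB addrC addrA subrK addrC.
by rewrite (sqnormD hip) sqnormZ (ipZr ip) (ipC ip s); field; rewrite gt_eqF.
Qed.

(** The step chosen by [prox_step] minimizes the objective, so by quadratic
    growth it agrees with any proximal point. *)
Lemma prox_stepP f w t : 0 < t ->
  (exists z, prox_point ip phi (w - t *: grad ip f w) t z) ->
  prox_point ip phi (w - t *: grad ip f w) t (w + prox_step ip f phi w t).
Proof.
move=> t0 [z hz]; set q := w - _ in hz *.
have wz : w + (z - w) = z by rewrite addrC subrK.
have dz : dom phi z by case: hz.
have /getPex : exists s, forall s',
    (prox_objective ip f phi w t s <= prox_objective ip f phi w t s')%E.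
  exists (z - w) => s'; have [ds|nds] := pselect (dom phi (w + s')); last first.
    by rewrite {2}/prox_objective (notin_dom nds) addey// leey.
  rewrite !prox_objectiveE ?wz// lee_fin lerD2r.
  apply: le_trans (prox_point_gap hip t0 hz ds).
  by rewrite lerDl mulr_ge0 ?exprn_ge0// invr_ge0 mulr_ge0// ltW.
move=> /(_ (z - w)); rewrite -/(prox_step ip f phi w t).
set p := prox_step _ _ _ _ _ => pmin.
have dp : dom phi (w + p).
  have [//|ndp] := pselect (dom phi (w + p)); move: pmin.
  rewrite (prox_objectiveE f (s := z - w)) ?wz// /prox_objective.
  by rewrite (notin_dom ndp) addey.
move: pmin; rewrite !prox_objectiveE ?wz// lee_fin lerD2r -/q => pmin.
have := le_trans (prox_point_gap hip t0 hz dp) pmin.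
rewrite gerDl pmulr_rle0 ?invr_gt0 ?mulr_gt0// => h.
suff -> : w + p = z by [].
by apply/subr0_eq/eqP; rewrite -normr_eq0 -sqrf_eq0 eq_le h sqr_ge0.
Qed.

End ProximalStep.

(** * Weak duality *)

Section Duality.
Context {R : realType} {W X : completeNormedModType R}.
Variable ip : {dot W for idfun}.
Hypothesis hip : norm_of_dot ip.
Variables (T : {linear W -> X}) (r : X -> \bar R).
Hypothesis T_continuous : continuous T.
Hypothesis r_gt : forall x, (-oo < r x)%E.
Let phi := r \o T.

(** Weak duality, i.e. Fenchel-Young for r at T v together with the square
    |t rho + (v - q)|^2 >= 0 for the Riesz representative rho of T^* mu: the
    finite dual value bounds the primal objective below, and the gap bounds
    the suboptimality of y. *)
Lemma gap_suboptimality q t y mu : 0 < t -> topdual mu ->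
  gap ip T r q t y mu \is a fin_num ->
  dom phi y /\ forall v, dom phi v ->
    fine (phi y) + (2 * t)^-1 * `|y - q| ^+ 2 - fine (gap ip T r q t y mu)
      <= fine (phi v) + (2 * t)^-1 * `|v - q| ^+ 2.
Proof.
move=> t0 muc; rewrite /gap /primal_value /dual_value.
rewrite fin_numB fin_numD fin_numB /= => /andP[ry cf].
split=> [|v dv]; first by rewrite /dom /= ltey_eq ry.
rewrite -(fineK ry) -(fineK cf) -!(EFinD,EFinB) /=.
have : mu (T v) - fine (phi v) <= fine (conjugate r mu).
  rewrite -lee_fin (fineK cf) EFinB (dom_fineK (fun x => r_gt (T x)) dv).
  by apply: ereal_sup_ubound; exists (T v).
have mc : continuous (mu \o T).
  by move=> x; apply: continuous_comp; [exact: T_continuous|exact: muc].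
have rE v' : ip (riesz_inv ip (mu \o T)) v' = mu (T v').
  exact: (@riesz_invE _ _ _ hip (mu \o T)).
rewrite /dual_norm; set rho := riesz_inv _ _ in rE *.
rewrite -!rE /phi /=.
have : 0 <= (2 * t)^-1 * `|t *: rho + (v - q)| ^+ 2.
  by rewrite mulr_ge0 ?exprn_ge0// invr_ge0 mulr_ge0// ltW.
rewrite (sqnormD hip) sqnormZ !(ipE ip).
have -> : (2 * t)^-1 * (t ^+ 2 * `|rho| ^+ 2
    + 2 * (t * ip rho v - t * ip rho q) + `|v - q| ^+ 2)
   = t / 2 * `|rho| ^+ 2 + (ip rho v - ip rho q) + (2 * t)^-1 * `|v - q| ^+ 2.
  by field; rewrite gt_eqF.
by lra.
Qed.

End Duality.

(** * Inexact proximal steps *)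

Section InexactStep.
Context {R : realType} {W : completeNormedModType R}.
Variable ip : {dot W for idfun}.
Hypothesis hip : norm_of_dot ip.
Variables (phi : W -> \bar R) (sigma : R).
Hypothesis sigma01 : 0 < sigma < 1.
Variables (w g p s : W) (t G : R).
Hypothesis t0 : 0 < t.
Let q := w - t *: g.
Hypothesis p_prox : prox_point ip phi q t (w + p).
Hypothesis s_dom : dom phi (w + s).
Hypothesis s_subopt :
  fine (phi (w + s)) + (2 * t)^-1 * `|w + s - q| ^+ 2 - G
    <= fine (phi (w + p)) + (2 * t)^-1 * `|w + p - q| ^+ 2.
Hypothesis s_test : G <= sigma ^+ 2 / (2 * t) * `|s| ^+ 2.

(** Quadratic growth bounds the distance to the exact step p by the
    suboptimality G, which the relative test bounds by sigma^2/(2t) |s|^2. *)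
Lemma inexact_step_error : `|s - p| <= sigma * `|s|.
Proof.
have /andP[sigma0 sigma1] := sigma01.
have := prox_point_gap hip t0 p_prox s_dom.
have -> : w + s - (w + p) = s - p by rewrite opprD addrACA subrr add0r.
move: s_subopt s_test => h1 h2 h3.
have : (2 * t)^-1 * `|s - p| ^+ 2 <= (2 * t)^-1 * (sigma * `|s|) ^+ 2.
  by rewrite exprMn; lra.
rewrite ler_pM2l ?invr_gt0 ?mulr_gt0// ler_pXn2r// nnegrE//.
by rewrite mulr_ge0//; lra.
Qed.

Lemma inexact_step_lower : (1 - sigma) * `|s| <= `|p|.
Proof.
have := inexact_step_error; have := ler_normD (s - p) p; rewrite subrK; lra.
Qed.

Lemma inexact_step_upper : `|p| <= 2 * `|s|.
Proof.
have /andP[sigma0 sigma1] := sigma01.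
have := inexact_step_error; have := ler_normD (p - s) s.
rewrite subrK distrC => h1 h2.
have : sigma * `|s| <= 1 * `|s| by rewrite ler_wpM2r//; lra.
by lra.
Qed.

(** The step s loses at most G against the exact step p, which gains at least
    |p|^2/(2t) over the zero step.  With |p| >= (1 - sigma) |s| the constants
    add up to 1 - sigma^2 + (1 - sigma)^2 = 2 (1 - sigma). *)
Lemma inexact_step_decrease : dom phi w ->
  ip g s + fine (phi (w + s)) - fine (phi w) <= - ((1 - sigma) / t * `|s| ^+ 2).
Proof.
move=> dw; have /andP[sigma0 sigma1] := sigma01.
have := prox_point_gap hip t0 p_prox dw.
have -> : w - (w + p) = - p by rewrite opprD addrA subrr add0r.
have -> : w - q = t *: g by rewrite /q opprB addrC subrK.
move: s_subopt; have -> : w + s - q = s + t *: g.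
  by rewrite /q opprB addrC addrA subrK addrC.
rewrite normrN (sqnormD hip) sqnormZ (ipZr ip) (ipC ip s).
have pE : ((1 - sigma) * `|s|) ^+ 2 <= `|p| ^+ 2.
  rewrite ler_pXn2r// ?nnegrE//; first exact: inexact_step_lower.
  by rewrite mulr_ge0//; lra.
have tc : 0 < (2 * t)^-1 by rewrite invr_gt0 mulr_gt0.
move: pE; rewrite -(ler_pM2l tc).
have -> : (1 - sigma) / t = (2 * t)^-1 * (2 * (1 - sigma)).
  by field; rewrite gt_eqF.
have gE : (2 * t)^-1 * (2 * (t * ip g s)) = ip g s by field; rewrite gt_eqF.
rewrite !mulrDr gE exprMn.
move: s_test; move: (`|w + p - q| ^+ 2) ((2 * t)^-1) => P c; lra.
Qed.

End InexactStep.

(** * Model decrease *)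

Section ModelDecrease.
Context {R : realType} {W : completeNormedModType R}.

Lemma opnorm_le (B : {linear W -> W}) x : bounded_fun_norm B ->
  `|B x| <= opnorm B * `|x|.
Proof.
move=> /(_ 1)[M hM].
have ub : has_ubound [set `|B x| | x in [set x : W | `|x| <= 1]].
  by exists M => _ [y y1 <-]; exact: hM.
have [->|x0] := eqVneq x 0; first by rewrite linear0 !normr0 mulr0.
have xp : 0 < `|x| by rewrite normr_gt0.
have x1 : `|(`|x|^-1 *: x)| <= 1.
  by rewrite normrZ ger0_norm ?invr_ge0// mulVf// gt_eqF.
have : `|B (`|x|^-1 *: x)| <= opnorm B.
  by apply: ub_le_sup => //; exists (`|x|^-1 *: x).
by rewrite linearZ normrZ ger0_norm ?invr_ge0// ler_pdivrMl// mulrC.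
Qed.

Lemma opnorm_ge0 (B : {linear W -> W}) : bounded_fun_norm B -> 0 <= opnorm B.
Proof.
move=> /(_ 1)[M hM].
apply: le_trans (ub_le_sup (x := 0) _ _) => //.
  by exists M => _ [y y1 <-]; exact: hM.
by exists 0; rewrite /= ?linear0 normr0.
Qed.

Variable ip : {dot W for idfun}.
Hypothesis hip : norm_of_dot ip.
Variables (f : W -> R^o) (phi : W -> \bar R).
Hypothesis phi_gt : forall x, (-oo < phi x)%E.

Lemma curvature_le (B : {linear W -> W}) s : bounded_fun_norm B ->
  `|ip (B s) s| <= opnorm B * `|s| ^+ 2.
Proof.
move=> Bb; apply: le_trans (cauchy_schwarz hip _ _) _.
by rewrite expr2 mulrA ler_wpM2r// opnorm_le.
Qed.

Lemma predictedE (B : {linear W -> W}) w s : dom phi w -> dom phi (w + s) ->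
  predicted ip f phi B w s = (fine (phi w) - fine (phi (w + s))
    - ip (grad ip f w) s - 2^-1 * ip (B s) s)%:E.
Proof.
move=> dw ds; rewrite /predicted /model addr0 !(ip0r ip) mulr0 !addr0.
rewrite -(dom_fineK phi_gt dw) -(dom_fineK phi_gt ds) -!(EFinD, EFinB).
by congr EFin; rewrite /=; ring.
Qed.

End ModelDecrease.

(** * The trust-region mechanism *)

(** Here a is the criticality measure, D the radius, F the objective values and
    acc the accepted iterations.  Iterates enter only through the bound
    |a (k+1) - a k| <= L D k, which is how far an accepted step can move a. *)
Section TrustRegionSequence.
Context {R : realType}.
Variables (a D F : nat -> R) (acc : nat -> bool) (L c theta gamma Flow : R).
Hypothesis (L0 : 0 <= L) (c0 : 0 < c) (theta0 : 0 < theta).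
Hypothesis (gamma01 : 0 < gamma < 1).
Hypothesis a_ge0 : forall k, 0 <= a k.
Hypothesis D_gt0 : forall k, 0 < D k.
Hypothesis F_ge : forall k, Flow <= F k.
Hypothesis acc_a : forall k, acc k -> `|a k.+1 - a k| <= L * D k.
Hypothesis acc_F : forall k, acc k -> c * a k * Num.min (a k) (D k) <= F k - F k.+1.
Hypothesis acc_D : forall k, acc k -> D k <= D k.+1.
Hypothesis rej_a : forall k, ~~ acc k -> a k.+1 = a k.
Hypothesis rej_F : forall k, ~~ acc k -> F k.+1 = F k.
Hypothesis rej_D : forall k, ~~ acc k -> D k.+1 = gamma * D k.
Hypothesis small_acc : forall k, D k <= theta * a k -> acc k.

Let F_step k : F k.+1 <= F k.
Proof.
have [ak|rk] := boolP (acc k); last by rewrite rej_F.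
rewrite -subr_ge0; apply: le_trans (acc_F ak).
by rewrite !mulr_ge0 ?le_min ?a_ge0 ?ltW.
Qed.

Let F_mono m n : (m <= n)%N -> F n <= F m.
Proof.
move=> /subnK<-; elim: (n - m)%N => // k IH.
by rewrite addSn; apply: le_trans (F_step _) IH.
Qed.

Let F_cauchy e : 0 < e -> exists N, forall m, (N <= m)%N -> F N - F m < e.
Proof.
move=> e0; have infF : has_inf (range F).
  by split; [exists (F 0%N), 0%N|exists Flow => _ [k _ <-]].
have [_ [N _ <-] hN] := inf_adherent e0 infF.
exists N => m _; rewrite ltrBlDr; apply: lt_le_trans hN _.
rewrite addrC lerD2l; apply: ge_inf; last by exists m.
by exists Flow => _ [k _ <-].
Qed.

(** If a stayed above e, a rejection would require D > theta e, so D would stay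
    above some d > 0 and each acceptance would decrease F by a fixed amount.
    Acceptances would thus come to an end, and then D would tend to 0. *)
Lemma criticality_liminf e K : 0 < e -> exists2 k, (K <= k)%N & a k < e.
Proof.
move=> e0; apply/not_exists2P => h.
have ae k : (K <= k)%N -> e <= a k.
  by move=> Kk; have [/(_ Kk)//|/negP] := h k; rewrite -leNgt.
pose d := Num.min (D K) (gamma * (theta * e)).
have g0 : 0 < gamma by case/andP: gamma01.
have d0 : 0 < d by rewrite lt_min D_gt0 !mulr_gt0.
have Dd k : (K <= k)%N -> d <= D k.
  move=> /subnK<-; elim: (k - K)%N => [|n IH]; first by rewrite ge_min lexx.
  rewrite addSn; set m := (n + K)%N in IH *.
  have [am|rm] := boolP (acc m); first exact: le_trans IH (acc_D am).
  rewrite rej_D// ge_min; apply/orP; right; rewrite ler_pM2l//.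
  have /negP := rm; move=> /(contra_not (@small_acc m))/negP; rewrite -ltNge.
  by move=> /ltW; apply: le_trans; rewrite ler_pM2l// ae// leq_addl.
have kap0 : 0 < c * e * Num.min e d by rewrite !mulr_gt0// lt_min e0.
have [N hN] := F_cauchy kap0.
pose M := maxn N K.
have rejM k : (M <= k)%N -> ~~ acc k.
  rewrite geq_max => /andP[Nk Kk]; apply/negP => ak.
  have := hN _ (leqW Nk); rewrite ltNge => /negP; apply.
  apply: le_trans (lerB (F_mono Nk) (lexx _)); apply: le_trans (acc_F ak).
  apply: ler_pM.
  - by rewrite mulr_ge0// ltW.
  - by rewrite le_min !ltW.
  - by rewrite ler_pM2l// ae.
  - by rewrite le_min; apply/andP; split; rewrite ge_min ?ae// (Dd k Kk) orbT.
have DE n : D (n + M)%N = D M * gamma ^+ n.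
  elim: n => [|n IH]; first by rewrite mulr1.
  by rewrite addSn rej_D ?rejM ?leq_addl// IH exprS mulrCA.
have dDM : 0 < d / D M by rewrite divr_gt0.
have cg : gamma ^+ n @[n --> \oo] --> (0 : R).
  by apply: cvg_expr; rewrite gtr0_norm//; case/andP: gamma01.
have [n _ /(_ n (leqnn _))/=] := cvgr_lt _ cg _ dDM.
rewrite ltr_pdivlMr// mulrC -DE ltNge => /negP; apply.
by apply: Dd; apply: leq_trans (leq_addl _ _); exact: leq_maxr.
Qed.

(** Let k0 be so large that F decreases by less than del after k0, and let l be
    the first later index with a l < e.  Before l each accepted step has
    c e D <= F - F', since the decrease is too small for the minimum to be
    attained by a.  Summing up, |a l - a k0| <= L/(c e) (F k0 - F l) <= e. *)
Lemma criticality_cvg0 : a @ \oo --> (0 : R).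
Proof.
apply/cvgr0Pnorm_lt => e2 e20.
have [e e0 e2E] : exists2 e, 0 < e & e2 = e + e.
  by exists (e2 / 2); rewrite ?divr_gt0// -splitr.
pose del := Num.min (c * e * e) (c * e * e / (L + 1)).
have L1 : 0 < L + 1 by rewrite ltr_wpDl.
have del0 : 0 < del by rewrite lt_min divr_gt0 ?mulr_gt0.
have [N hN] := F_cauchy del0.
near=> k0.
have Nk0 : (N <= k0)%N by near: k0; exists N.
rewrite ger0_norm//.
have [l0 kl0 al0] := criticality_liminf k0 e0.
have exl : exists n, a (n + k0)%N < e by exists (l0 - k0)%N; rewrite subnK.
have [l al lmin] := ex_minnP exl.
have ae i : (i < l)%N -> e <= a (i + k0)%N.
  by move=> il; rewrite leNgt; apply/negP => /lmin; rewrite leqNgt il.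
have ce : 0 < c * e by rewrite mulr_gt0.
have dist j : (j <= l)%N ->
    c * e * `|a (j + k0)%N - a k0| <= L * (F k0 - F (j + k0)%N).
  elim: j => [_|j IH jl]; first by rewrite add0n !subrr normr0 !mulr0.
  set m := (j + k0)%N in IH *; rewrite addSn -/m.
  have := IH (ltnW jl) => {}IH.
  have [am|rm] := boolP (acc m); last by rewrite rej_a// rej_F.
  have h := acc_F am.
  have em : e <= a m by exact: ae.
  have Nm : (N <= m)%N by apply: leq_trans (leq_addl _ _).
  have small : F m - F m.+1 < c * e * e.
    apply: lt_le_trans (_ : del <= _); last by rewrite ge_min lexx.
    by apply: le_lt_trans (hN m.+1 (leqW Nm)); rewrite lerB ?F_mono.
  have cDF : c * e * D m <= F m - F m.+1.
    apply: le_trans h.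
    have [aD|/ltW Da] := leP (D m) (a m).
      by rewrite ler_pM2r// ler_pM2l.
    have : c * e * e <= F m - F m.+1; last by rewrite leNgt small.
    apply: le_trans (acc_F am); rewrite (min_idPl Da).
    by rewrite -!mulrA ler_pM2l// ler_pM// ltW.
  have := ler_normD (a m.+1 - a m) (a m - a k0); rewrite addrA subrK => tri.
  apply: le_trans (_ : c * e * (`|a m.+1 - a m| + `|a m - a k0|) <= _).
    by rewrite ler_pM2l.
  have h1 : c * e * `|a m.+1 - a m| <= L * (F m - F m.+1).
    apply: le_trans (_ : c * e * (L * D m) <= _); first by rewrite ler_pM2l ?acc_a.
    by rewrite mulrCA ler_wpM2l.
  by rewrite mulrDr; lra.
have := dist l (leqnn _) => dl.
have dF : F k0 - F (l + k0)%N < c * e * e / (L + 1).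
  apply: lt_le_trans (_ : del <= _); last by rewrite ge_min lexx orbT.
  apply: le_lt_trans (hN (l + k0)%N (leq_trans Nk0 (leq_addl _ _))).
  by rewrite lerB ?F_mono.
have : c * e * `|a (l + k0)%N - a k0| <= c * e * e.
  apply: le_trans dl _.
  have F0 : 0 <= F k0 - F (l + k0)%N by rewrite subr_ge0 F_mono// leq_addl.
  move: dF; rewrite ltr_pdivlMr// => /ltW; apply: le_trans.
  by rewrite mulrC ler_wpM2l//; lra.
rewrite ler_pM2l// ler_norml => /andP[h _].
by rewrite e2E; lra.
Unshelve. all: by end_near. Qed.

End TrustRegionSequence.

(** * Bounded sequences in finite dimension *)

Section FiniteDimension.
Context {R : realType} {W : completeNormedModType R}.
Variable ip : {dot W for idfun}.
Hypothesis hip : norm_of_dot ip.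

(** Coordinates of a finite-dimensional space are taken with respect to a finite
    family u on whose span this operator is the identity (a Parseval frame).
    Unlike an orthonormal basis, such a family needs no indexing and no proof of
    distinctness. *)
Definition frame_operator (u : seq W) (v : W) : W := \sum_(x <- u) ip v x *: x.

Lemma frame_operatorD u v v' :
  frame_operator u (v + v') = frame_operator u v + frame_operator u v'.
Proof.
rewrite -big_split; apply: eq_bigr => x _ /=.
by rewrite (ipDl ip) scalerDl.
Qed.

Lemma frame_operatorZ u a v : frame_operator u (a *: v) = a *: frame_operator u v.
Proof.
by rewrite scaler_sumr; apply: eq_bigr => x _; rewrite (ipZl ip) scalerA.
Qed.

Lemma frame_operator_sym u v v' :
  ip (frame_operator u v) v' = ip v (frame_operator u v').
Proof.
rewrite /frame_operator; elim: u => [|x u IH].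
  by rewrite !big_nil (ip0r ip) (ipC ip) (ip0r ip).
by rewrite !big_cons !(ipE ip) IH (ipC ip x v') mulrC (mulrC (ip v' x)).
Qed.

(** The Gram-Schmidt process: the component e' of e orthogonal to the span of u
    is normalized and added to u. *)
Lemma parseval_frame_exists (s : seq W) : exists u : seq W,
  {in u, forall x, frame_operator u x = x} /\
  {in s, forall v, frame_operator u v = v}.
Proof.
elim: s => [|e s [u [uu us]]]; first by exists [::].
pose e' := e - frame_operator u e.
have ue' : {in u, forall y, ip e' y = 0}.
  by move=> y yu; rewrite (ipDl ip) (ipNl ip) frame_operator_sym uu// subrr.
have Su0 v : {in u, forall y, ip v y = 0} -> frame_operator u v = 0.
  move=> vu; rewrite /frame_operator big_seq big1// => y yu.
  by rewrite vu// scale0r.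
have [e'0|e'n0] := eqVneq e' 0.
  exists u; split=> // v; rewrite inE => /orP[/eqP->|]; last exact: us.
  by apply/esym/subr0_eq.
pose x := `|e'|^-1 *: e'.
have xu : {in u, forall y, ip x y = 0}.
  by move=> y yu; rewrite (ipZl ip) ue'// mulr0.
have e'E : ip e' x *: x = e'.
  rewrite (ipZr ip) hip scalerA [X in X *: _](_ : _ = 1) ?scale1r//.
  by rewrite expr2 mulKf ?divff ?normr_eq0.
have xE : ip x x *: x = x.
  by rewrite {1}/x (ipZl ip) -scalerA e'E.
have SE v : frame_operator (x :: u) v = ip v x *: x + frame_operator u v.
  by rewrite /frame_operator big_cons.
have fixS v : frame_operator u v = v -> frame_operator (x :: u) v = v.
  by move=> vE; rewrite SE -{1}vE frame_operator_sym Su0// (ip0r ip) scale0r add0r.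
exists (x :: u); split=> v; rewrite inE => /orP[/eqP->|].
- by rewrite SE xE Su0// addr0.
- by move=> /uu/fixS.
- have eE : e = e' + frame_operator u e by rewrite subrK.
  rewrite SE {1}eE (ipDl ip) frame_operator_sym Su0// (ip0r ip) addr0 e'E.
  by rewrite -eE.
- by move=> /us/fixS.
Qed.

Lemma finite_dimensional_frame : finite_dimensional W ->
  exists u, forall v, frame_operator u v = v.
Proof.
move=> [n [e he]]; have [u [_ hu]] := parseval_frame_exists (codom e).
exists u => v; have [c ->] := he v.
elim/big_ind : _ => [|x y xE yE|i _].
- by rewrite -(scale0r (0 : W)) frame_operatorZ !scale0r.
- by rewrite frame_operatorD xE yE.
- by rewrite frame_operatorZ hu// codom_f.
Qed.

Lemma ultra_fmap (S S' : Type) (h : S -> S') (U : set_system S) :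
  UltraFilter U -> UltraFilter (h @ U).
Proof.
move=> UU; split; first exact: fmap_proper_filter.
move=> G PG UG; apply/seteqP; split=> // A GA.
have [//|UnA] := in_ultra_setVsetC (h @^-1` A) UU.
have GnA : G (~` A) by exact: UG.
have : G (A `&` ~` A) by exact: filterI.
by rewrite setICr => /filter_not_empty.
Qed.

(** Along an ultrafilter finer than the sequence, each of the finitely many
    bounded coordinates (v, x) converges, and the frame recovers the point. *)
Lemma bounded_seq_cluster (w : nat -> W) : finite_dimensional W ->
  bounded_fun w -> exists wbar, cluster (w k @[k --> \oo]) wbar.
Proof.
move=> /finite_dimensional_frame[u hu] /pinfty_ex_gt0[M M0 hM].
have [U [Uu wU]] :=
  @ultraFilterLemma _ (w k @[k --> \oo]) _.
have UM : \forall v \near U, `|v| <= M.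
  by apply: wU; exists 0%N => // k _; exact: hM.
have coord x : exists c : R, ip v x @[v --> U] --> c.
  have : compact `[- (M * `|x|), M * `|x|]%classic by exact: segment_compact.
  rewrite compact_ultra => /(_ (ip v x @[v --> U]) (ultra_fmap _ Uu))[].
    apply: (@filterS _ U _ _ _ _ UM) => v vM /=; rewrite in_itv /= -ler_norml.
    by apply: le_trans (cauchy_schwarz hip _ _) _; rewrite ler_wpM2r.
  by move=> c [_ hc]; exists c.
have [l hl] : exists l : W, frame_operator u v @[v --> U] --> l.
  rewrite /frame_operator; elim: (u) => [|x s [l hl]].
    by exists 0; under eq_fun do rewrite big_nil; exact: cvg_cst.
  have [c hc] := coord x; exists (c *: x + l).
  under eq_fun do rewrite big_cons.
  by apply: cvgD => //; apply: cvgZr_tmp.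
exists l; rewrite cluster_cvgE; exists U; first exact: ultra_proper.
split=> //; suff -> : U = (frame_operator u v @[v --> U]) by [].
by rewrite (_ : (fun v => _) = id) //; apply/funext => v; exact: hu.
Qed.

End FiniteDimension.

(** * Stationarity of limits *)

Section StationaryLimit.
Context {R : realType} {W : completeNormedModType R}.
Variable ip : {dot W for idfun}.
Hypothesis hip : norm_of_dot ip.
Variables (f : W -> R^o) (phi : W -> \bar R).
Hypothesis f_diff : forall w, differentiable f w.
Hypothesis phi_gt : forall x, (-oo < phi x)%E.
Hypothesis phi_closed : forall c : R, closed [set x | (phi x <= c%:E)%E].
Hypothesis phi_proper : dom phi !=set0.

Lemma stationaryI wbar :
  (forall v, dom phi v ->
    (phi wbar <= (fine (phi v) + ip (grad ip f wbar) (v - wbar))%:E)%E) ->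
  stationary f phi wbar.
Proof.
move=> h; have dw : dom phi wbar.
  by have [v dv] := phi_proper; apply: le_lt_trans (h v dv) (ltry _).
(* The only candidate for the subgradient is - f'(wbar). *)
split=> //; exists (\- 'd f wbar)%R => [|v]; last exact: addrN.
split=> [x||v]; [|exact: dw|].
  by apply: continuousN; exact: diff_continuous.
have [dv|ndv] := pselect (dom phi v); last first.
  by rewrite (notin_dom ndv) leey.
have := h v dv.
rewrite -(dom_fineK phi_gt dw) -(dom_fineK phi_gt dv) -EFinD !lee_fin.
by rewrite /= gradE//; move: ('d f wbar (v - wbar)) => x; lra.
Qed.

(** The proximal points u + p u tend to wbar, and for fixed v the variational
    inequality bounds phi (u + p u) by a quantity c u that tends to
    phi v + (grad f wbar, v - wbar); the closed sublevel sets of phi transfer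
    the bound to wbar. *)
Lemma prox_residual_limit_stationary (tau : R) (G : set_system W) (wbar : W)
    (p : W -> W) : 0 < tau -> ProperFilter G -> G --> wbar ->
  {for wbar, continuous (grad ip f)} ->
  (\forall u \near G, prox_point ip phi (u - tau *: grad ip f u) tau (u + p u)) ->
  p u @[u --> G] --> (0 : W) ->
  stationary f phi wbar.
Proof.
move=> tau0 PG Gw gc hp p0; apply: stationaryI => v dv.
set g := grad ip f in gc hp *.
have uG : u @[u --> G] --> wbar by [].
have gG : g u @[u --> G] --> g wbar by apply: cvg_comp Gw gc.
have zG : u + p u @[u --> G] --> wbar by rewrite -[X in _ --> X]addr0; apply: cvgD.
pose c u := fine (phi v) - tau^-1 * ip (u - tau *: g u - (u + p u)) (v - (u + p u)).
have cG : c u @[u --> G] --> fine (phi v) + ip (g wbar) (v - wbar).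
  have -> : fine (phi v) + ip (g wbar) (v - wbar) =
      fine (phi v) - tau^-1 * ip (wbar - tau *: g wbar - (wbar + 0)) (v - wbar).
    rewrite addr0 addrAC subrr add0r (ipNl ip) (ipZl ip) mulrN opprK mulKf//.
    by rewrite gt_eqF.
  apply: cvgB; first exact: cvg_cst.
  apply: cvgM; first exact: cvg_cst.
  apply: cvg_ip => //; last by apply: cvgB => //; exact: cvg_cst.
  apply: cvgB; last exact: cvgD.
  by apply: cvgB => //; apply: cvgZl_tmp.
set L := _ + _ in cG *.
apply/lee_addgt0Pr => e /= e0; rewrite -EFinD.
apply: (closed_cvg _ (@phi_closed (L + e)) _ wbar zG).
have Le : L < L + e by rewrite ltrDl.
near=> u => /=.
have [dz /(_ v dv)] : prox_point ip phi (u - tau *: g u) tau (u + p u).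
  by near: u.
rewrite -(dom_fineK phi_gt dz) lee_fin.
have : c u < L + e by near: u; exact: (cvgr_lt L cG _ Le).
by rewrite /c; lra.
Unshelve. all: by end_near. Qed.

End StationaryLimit.

(** * The Cauchy step *)

Section CauchyStep.
Context {R : realType} {W X : completeNormedModType R}.
Variable ip : {dot W for idfun}.
Hypothesis hip : norm_of_dot ip.
Variables (T : {linear W -> X}) (r : X -> \bar R) (f : W -> R^o).
Hypothesis T_continuous : continuous T.
Hypothesis r_gt : forall x, (-oo < r x)%E.
Let phi := r \o T.
Hypothesis phi_convex : econvex phi.
Hypothesis phi_closed : forall c : R, closed [set x | (phi x <= c%:E)%E].
Variable inner : W -> R -> set (inner_run W X).
Hypothesis hinner : inner_approximation ip T r f inner.

Let phi_gt x : (-oo < phi x)%E. Proof. exact: r_gt. Qed.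

(** Any run of the inner procedure has a finite dual value, which is the lower
    bound that the existence of the proximal point requires. *)
Lemma prox_step_of_inner w t : dom phi w -> 0 < t ->
  prox_point ip phi (w - t *: grad ip f w) t (w + prox_step ip f phi w t).
Proof.
move=> dw t0; apply: prox_stepP => //.
have [[rn rnP] /(_ rn rnP)[muc gapfin _ _ _]] := hinner dw t0.
have [_ h] := gap_suboptimality hip T_continuous r_gt t0 (muc 0%N) (gapfin 0%N).
by apply: (prox_point_exists hip phi_gt phi_convex phi_closed t0 _ h); exists w.
Qed.

Variables (tau sigma zeta bmax : R).
Hypothesis (tau0 : 0 < tau) (sigma01 : 0 < sigma < 1) (zeta01 : 0 < zeta < 1).

Lemma relative_test_step w t rn i : dom phi w -> 0 < t ->
    inner w t rn -> relative_test sigma w t rn i ->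
  let s := run_step w rn i in let p := prox_step ip f phi w t in
  [/\ dom phi (w + s), (1 - sigma) * `|s| <= `|p|, `|p| <= 2 * `|s|
    & ip (grad ip f w) s + fine (phi (w + s)) - fine (phi w)
        <= - ((1 - sigma) / t * `|s| ^+ 2)].
Proof.
move=> dw t0 rnP test s p.
have [_ /(_ rn rnP)[muc gapfin _ gapub _]] := hinner dw t0.
have [dy h] := gap_suboptimality hip T_continuous r_gt t0 (muc i) (gapfin i).
have hp : prox_point ip phi (w - t *: grad ip f w) t (w + p).
  exact: prox_step_of_inner.
have ys : w + s = run_y rn i by rewrite /s /run_step addrC subrK.
have ds : dom phi (w + s) by rewrite ys.
have sub : fine (phi (w + s)) +
    (2 * t)^-1 * `|w + s - (w - t *: grad ip f w)| ^+ 2 - run_gap rn i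
    <= fine (phi (w + p)) + (2 * t)^-1 * `|w + p - (w - t *: grad ip f w)| ^+ 2.
  rewrite ys; apply: le_trans (h _ (proj1 hp)).
  by rewrite lerD2l lerN2 -lee_fin fineK//; exact: gapub.
split=> //.
- exact: (inexact_step_lower hip sigma01 t0 hp ds sub test).
- exact: (inexact_step_upper hip sigma01 t0 hp ds sub test).
- exact: (inexact_step_decrease hip sigma01 t0 hp ds sub test).
Qed.

(** The smallest initial length min(tau, (1 - sigma)/(1 + bmax)) accounts for
    searches that stop at once, and zeta (1 - sigma) for those that reject at
    least one length. *)
Definition cauchy_constant : R :=
  (1 - sigma) / 8 *
    Num.min (Num.min tau ((1 - sigma) / (1 + bmax))) (zeta * (1 - sigma)).

Lemma cauchy_constant_gt0 : 0 <= bmax -> 0 < cauchy_constant.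
Proof.
move=> b0; have /andP[sigma0 sigma1] := sigma01; have /andP[zeta0 _] := zeta01.
rewrite /cauchy_constant mulr_gt0 ?divr_gt0 ?subr_gt0//.
by rewrite !lt_min tau0/= divr_gt0 ?mulr_gt0 ?subr_gt0// ltr_pwDl.
Qed.

(** The decrease is at least (1 - sigma)/4 chi |s|, because |s| dominates t chi/2.
    For |s| itself there are two cases.  If the first length was accepted, then
    t is bounded below and |s| >= t chi/2.  Otherwise the step at t/zeta was
    longer than Delta, hence so was (up to 1 - sigma) the exact step at t/zeta,
    and by monotonicity of the residual the one at t up to a factor zeta. *)
Lemma cauchy_search_decrease (B : {linear W -> W}) w Delta sC : dom phi w ->
    bounded_fun_norm B -> opnorm B <= bmax ->
    cauchy_search inner tau sigma zeta B w Delta sC ->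
  let x := chi ip f phi tau w in
  dom phi (w + sC) /\
  ((cauchy_constant * x * Num.min x Delta)%:E <= predicted ip f phi B w sC)%E.
Proof.
move=> dw Bb Bmax hs x; have [jC [rn [i /=[hrun hlong hshort ->]]]] := hs.
have /andP[sigma0 sigma1] := sigma01; have /andP[zeta0 zeta1] := zeta01.
have b0 : 0 <= opnorm B by exact: opnorm_ge0.
pose tb := cauchy_t0 tau sigma B.
have tb0 : 0 < tb by rewrite lt_min tau0/= divr_gt0 ?subr_gt0// ltr_pwDl.
pose t j := cauchy_t tau sigma zeta B j.
have t0 j : 0 < t j by rewrite mulr_gt0 ?exprn_gt0.
have ttb j : t j <= tb.
  by rewrite /t /cauchy_t -/tb ger_pMl// exprn_ile1// ltW.
have ttau j : t j <= tau by apply: le_trans (ttb j) _; rewrite ge_min lexx.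
have step j (jj : (j <= jC)%N) := relative_test_step dw (t0 j)
  (proj1 (hrun j jj)) (proj1 (proj2 (hrun j jj))).
have [ds _ pub dec] := step jC (leqnn _).
set s := run_step w (rn jC) (i jC) in ds pub dec *.
set p := prox_step _ _ _ _ _ in pub.
have hp j : prox_point ip phi (w - t j *: grad ip f w) (t j)
    (w + prox_step ip f phi w (t j)) by exact: prox_step_of_inner.
have x0 : 0 <= x by rewrite mulr_ge0// invr_ge0 ltW.
have xp : x <= (t jC)^-1 * `|p|.
  apply: (prox_residual_nonincreasing hip (t0 jC) (ttau jC) (hp jC)).
  exact: prox_step_of_inner.
have xs : x * t jC <= 2 * `|s|.
  by apply: le_trans pub; rewrite mulrC -ler_pdivlMl.
have model_decrease : (1 - sigma) / 4 * x * `|s| <= fine (predicted ip f phi B w s).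
  rewrite predictedE//=.
  have := curvature_le hip s Bb; rewrite ler_norml => /andP[_ curv].
  have tB : opnorm B <= (1 - sigma) / t jC.
    rewrite ler_pdivlMr//.
    apply: le_trans (_ : opnorm B * ((1 - sigma) / (1 + opnorm B)) <= _).
      rewrite ler_wpM2l//; apply: le_trans (ttb jC) _.
      by rewrite ge_min lexx orbT.
    rewrite mulrCA ler_piMr//; first by rewrite subr_ge0 ltW.
    by rewrite ler_pdivrMr ?ltr_pwDl// mul1r lerDr.
  have curv' : ip (B s) s <= (1 - sigma) / t jC * `|s| ^+ 2.
    by apply: le_trans curv _; rewrite ler_wpM2r// exprn_ge0.
  apply: le_trans (_ : 2^-1 * ((1 - sigma) / t jC * `|s| ^+ 2) <= _); last first.
    by move: dec curv'; move: ((1 - sigma) / t jC * `|s| ^+ 2) => K; lra.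
  rewrite mulrAC.
  have -> : 2^-1 * ((1 - sigma) / t jC * `|s| ^+ 2)
      = (1 - sigma) / 4 * `|s| * (2 * `|s| / t jC).
    by field; rewrite gt_eqF.
  by rewrite ler_wpM2l ?ler_pdivlMr// mulr_ge0// divr_ge0// subr_ge0 ltW.
split=> //.
rewrite -[X in (_ <= X)%E]fineK; last by rewrite predictedE.
rewrite lee_fin; apply: le_trans model_decrease.
set m := Num.min (Num.min tau ((1 - sigma) / (1 + bmax))) (zeta * (1 - sigma)).
have m0 : 0 < m.
  rewrite !lt_min tau0/= divr_gt0 ?mulr_gt0 ?subr_gt0// ltr_pwDl//.
  exact: le_trans Bmax.
suff hm : m * Num.min x Delta <= 2 * `|s|.
  rewrite /cauchy_constant -/m.
  have -> : (1 - sigma) / 8 * m * x * Num.min x Delta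
    = (1 - sigma) / 4 * x * (2^-1 * (m * Num.min x Delta)) by field.
  rewrite ler_wpM2l//; last by rewrite ler_pdivrMl.
  by rewrite mulr_ge0// divr_ge0// subr_ge0 ltW.
have min0 : 0 <= Num.min x Delta.
  by rewrite le_min x0; apply: le_trans hshort.
have [j0|jpos] := posnP jC.
  apply: le_trans xs; rewrite mulrC; apply: ler_pM => //; first exact: ltW.
    by rewrite ge_min lexx.
  have -> : t jC = tb by rewrite /t /cauchy_t j0 expr0 mul1r.
  rewrite /tb /cauchy_t0 le_min; apply/andP; split.
    by rewrite !ge_min lexx.
  apply: le_trans (_ : (1 - sigma) / (1 + bmax) <= _).
    by rewrite !ge_min lexx orbT.
  rewrite ler_wpM2l ?subr_ge0 ?(ltW sigma1)// lef_pV2 ?lerD2l//.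
    by rewrite posrE ltr_pwDl// (le_trans b0).
  by rewrite posrE ltr_pwDl.
apply: le_trans pub.
have jlt : (jC.-1 < jC)%N by rewrite prednK.
have tE : t jC = zeta * t jC.-1.
  by rewrite /t /cauchy_t -[in LHS](prednK jpos) exprS mulrA.
have := hlong _ jlt; have [_ + _ _] := step _ (ltnW jlt).
set p' := prox_step _ _ _ _ _; move: (run_step _ _ _) => s' low long.
have tle : t jC <= t jC.-1 by rewrite tE ger_pMl// ltW.
have := prox_residual_nonincreasing hip (t0 _) tle (hp _) (hp _).
rewrite -/p -/p' tE; move: (t jC.-1) (t0 jC.-1) => t' t'0.
rewrite invfM -mulrA (mulrCA zeta^-1) ler_pM2l ?invr_gt0//.
rewrite ler_pdivlMl// => zp.
apply: le_trans zp; apply: le_trans (_ : zeta * (1 - sigma) * Delta <= _).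
  by apply: ler_pM => //; [exact: ltW| |]; rewrite ge_min lexx orbT.
rewrite -mulrA ler_pM2l//; apply: le_trans low.
by rewrite ler_pM2l ?subr_gt0// ltW.
Qed.

End CauchyStep.

(** * Convergence *)

Theorem theorem4p6 (R : realType) (W X : completeNormedModType R)
    (ip : {dot W for idfun}) (T : {linear W -> X}) (r : X -> \bar R)
    (f : W -> R^o) (Lf Flow : R)
    (tau sigma zeta nu eta1 eta2 gammac gammae Dmax bmax : R)
    (inner : W -> R -> set (inner_run W X))
    (B : nat -> {linear W -> W})
    (w sC d : nat -> W) (Delta : nat -> R)
    (phi := r \o T)
    (hip : norm_of_dot ip)
    (hT : bounded_fun_norm T)
    (hr : proper_function r) (hrconv : econvex r) (hrlsc : lower_semicontinuous r)
    (hphi : dom phi !=set0)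
    (hf : continuously_frechet_differentiable ip f)
    (hLf : 0 <= Lf) (hgrad : Lf.-lipschitz (grad ip f))
    (hFlow : forall v, dom phi v -> (Flow%:E <= objective f phi v)%E)
    (htau : 0 < tau) (hsigma : 0 < sigma < 1) (hzeta : 0 < zeta < 1)
    (hnu : 0 < nu <= 1) (heta1 : 0 < eta1) (heta12 : eta1 < eta2)
    (heta2 : eta2 < 1) (hgammac : 0 < gammac < 1)
    (hgammae : 1 < gammae) (hDmax : 0 < Dmax)
    (hinner : inner_approximation ip T r f inner)
    (hBbounded : forall k, bounded_fun_norm (B k))
    (hBsa : forall k, self_adjoint ip (B k))
    (hB : forall k, opnorm (B k) <= bmax)
    (hw0 : dom phi (w 0%N)) (hDelta0 : 0 < Delta 0%N <= Dmax)
    (hchi : forall k, 0 < chi ip f phi tau (w k))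
    (hsC : forall k,
      cauchy_search inner tau sigma zeta (B k) (w k) (Delta k) (sC k))
    (hd : forall k, trial_step ip f phi nu (B k) (w k) (Delta k) (sC k) (d k))
    (hupd : forall k, update ip f phi eta1 eta2 gammac gammae Dmax (B k) (w k) (d k)
      (Delta k) (w k.+1) (Delta k.+1)) :
  [/\ chi ip f phi tau (w k) @[k --> \oo] --> (0 : R),
      forall wbar, cluster (w k @[k --> \oo]) wbar -> stationary f phi wbar
    & finite_dimensional W ->
      (forall wbar, cluster (w k @[k --> \oo]) wbar -> stationary f phi wbar) /\
      (bounded_fun w ->
       exists2 wbar, cluster (w k @[k --> \oo]) wbar & stationary f phi wbar)].
Proof.
have /andP[sigma0 sigma1] := hsigma; have /andP[nu0 nu1] := hnu.
have /andP[gc0 gc1] := hgammac.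
have T_continuous : continuous T.
  by apply/linear_bounded_continuous/bounded_funP.
have [r_gt _] := hr.
have phi_gt x : (-oo < phi x)%E by exact: r_gt.
have phi_convex : econvex phi.
  by move=> x y a a01; rewrite /phi /= linearD !linearZ; exact: hrconv.
have phi_closed c : closed [set x | (phi x <= c%:E)%E].
  rewrite (_ : mkset _ = ~` (T @^-1` [set x | (c%:E < r x)%E])).
    apply: open_closedC; apply: open_comp; first by move=> x _; exact: T_continuous.
    by move/lower_semicontinuousP : hrlsc; exact.
  by apply/seteqP; split=> x /=; rewrite leNgt => /negP.
have [f_diff _] := hf.
pose g := grad ip f.
have glip u v : `|g u - g v| <= Lf * `|u - v| by exact: (hgrad (u, v)).
pose x k := chi ip f phi tau (w k).
pose p := prox_step ip f phi ^~ tau.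
have pE u : dom phi u -> prox_point ip phi (u - tau *: g u) tau (u + p u).
  move=> du.
  exact: (prox_step_of_inner hip T_continuous r_gt phi_convex phi_closed hinner).
have bmax0 : 0 <= bmax by apply: le_trans (hB 0%N); exact: opnorm_ge0.
pose kappa := cauchy_constant tau sigma zeta bmax.
have kappa0 : 0 < kappa by exact: cauchy_constant_gt0.
pose F k := f (w k) + fine (phi (w k)).
pose rho k := reduction_ratio ip f phi (B k) (w k) (d k).
have inv k : dom phi (w k) /\ 0 < Delta k <= Dmax.
  elim: k => [|k [dk /andP[D0 Dm]]]; first by [].
  have [dd dde _] := hd k; have [h1 h2 h3] := hupd k.
  have [/h1[-> ->]|r1] := ltP (rho k) eta1.
    by rewrite mulr_gt0//=; split=> //; apply: le_trans Dm; rewrite ger_pMl// ltW.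
  have [r2|/h3[-> ->]] := ltP (rho k) eta2.
    have [|-> ->] := h2; first by apply/andP.
    by rewrite D0.
  split=> //; rewrite lt_min hDmax ge_min lexx orbT !andbT.
  by rewrite mulr_gt0// (lt_trans ltr01).
have dw k := proj1 (inv k).
have D0 k : 0 < Delta k by have [_ /andP[]] := inv k.
have Dm k : Delta k <= Dmax by have [_ /andP[]] := inv k.
pose P k := fine (predicted ip f phi (B k) (w k) (d k)).
have dwd k : dom phi (w k + d k) by have [] := hd k.
have dD k : `|d k| <= Delta k by have [] := hd k.
pose Fd k := f (w k + d k) + fine (phi (w k + d k)).
have PE k : nu * kappa * x k * Num.min (x k) (Delta k) <= P k.
  have [_ _ hpred] := hd k.
  have [dsC hC] := cauchy_search_decrease hip T_continuous r_gt phi_convex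
    phi_closed hinner htau hsigma hzeta (dw k) (hBbounded k) (hB k) (hsC k).
  move: hC hpred; rewrite /P !predictedE// -EFinM !lee_fin /= => hC hpred.
  apply: le_trans hpred; rewrite -!(mulrA nu); apply: ler_wpM2l hC; exact: ltW.
(* From here on kappa is an arbitrary positive constant for which PE holds. *)
clearbody kappa.
have x_gt0 k : 0 < x k by exact: hchi.
have P0 k : 0 < P k.
  apply: lt_le_trans (PE k); rewrite mulr_gt0 ?lt_min ?x_gt0 ?D0//.
  by rewrite mulr_gt0// mulr_gt0.
have rhoE k : rho k = (F k - Fd k) / P k.
  rewrite /rho /reduction_ratio /objective; congr (_ / _).
  by rewrite -(dom_fineK phi_gt (dw k)) -(dom_fineK phi_gt (dwd k)) -!(EFinD, EFinB).
(* The model error is of the order of Delta^2 and P of the order of chi Delta,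
   so that rho is close to 1 when Delta is small against chi. *)
have model_error k : P k - (Lf + bmax) * Delta k ^+ 2 <= F k - Fd k.
  rewrite /P predictedE//=.
  have := linearization_error hip f_diff (w k) (d k) hLf hgrad.
  rewrite ler_norml => /andP[_].
  have := curvature_le hip (d k) (hBbounded k).
  rewrite ler_norml => /andP[+ _].
  have d2 : `|d k| ^+ 2 <= Delta k ^+ 2 by rewrite ler_pXn2r// ?nnegrE// ltW.
  have : opnorm (B k) * `|d k| ^+ 2 <= bmax * Delta k ^+ 2.
    by apply: ler_pM => //; rewrite ?exprn_ge0// opnorm_ge0.
  have : Lf * `|d k| ^+ 2 <= Lf * Delta k ^+ 2 by rewrite ler_wpM2l.
  have : 0 <= bmax * Delta k ^+ 2 by rewrite mulr_ge0// exprn_ge0// ltW.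
  rewrite /F /Fd; move: (ip (B k (d k)) (d k)) (ip (grad ip f (w k)) (d k)) => b gd.
  move: (f (w k + d k)) (f (w k)) => f1 f0.
  by lra.
pose acc k := eta1 <= rho k.
have acc_w k : acc k -> w k.+1 = w k + d k /\ Delta k <= Delta k.+1.
  move=> ak; have [_ h2 h3] := hupd k.
  have [r2|/h3[-> ->]] := ltP (rho k) eta2.
    have [|-> ->] := h2; first by apply/andP.
    by [].
  by split=> //; rewrite le_min Dm andbT ler_peMl// ltW.
have rej_w k : ~~ acc k -> w k.+1 = w k /\ Delta k.+1 = gammac * Delta k.
  by rewrite -ltNge; have [h1 _ _] := hupd k; exact: h1.
(* The proximal map is nonexpansive and q = u - tau g u is (1 + tau Lf)-Lipschitz
   in u; the residual p u = prox - u adds another 1. *)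
have chi_lip u v : dom phi u -> dom phi v ->
    `|chi ip f phi tau u - chi ip f phi tau v| <= (2 * tau^-1 + Lf) * `|u - v|.
  move=> du dv; rewrite /chi -mulrBr normrM gtr0_norm ?invr_gt0//.
  rewrite ler_pdivrMl//.
  apply: le_trans (ler_dist_dist _ _) _.
  have h := prox_point_nonexpansive hip htau (pE _ dv) (pE _ du).
  have residualE (a b a' b' : W) : b - b' = (a + b - (a' + b')) - (a - a').
    by rewrite opprD addrACA [RHS]addrC addKr.
  rewrite (residualE u _ v).
  apply: le_trans (ler_normB _ _) _.
  have : `|u - tau *: g u - (v - tau *: g v)| <= `|u - v| + tau * (Lf * `|u - v|).
    have -> : u - tau *: g u - (v - tau *: g v) = (u - v) - tau *: (g u - g v).
      by rewrite scalerBr !opprD !opprK addrACA.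
    apply: le_trans (ler_normB _ _) _; rewrite lerD2l normrZ gtr0_norm//.
    by rewrite ler_pM2l.
  have -> : tau * ((2 * tau^-1 + Lf) * `|u - v|)
      = `|u - v| + tau * (Lf * `|u - v|) + `|u - v| by field; rewrite gt_eqF.
  by move=> hq; rewrite lerD2r; exact: le_trans h hq.
(* With this theta, (Lf + bmax) Delta^2 <= (1 - eta1) P when
   Delta <= theta chi, i.e. rho >= eta1. *)
pose theta := Num.min 1 ((1 - eta1) * (nu * kappa) / (Lf + bmax + 1)).
have M1 : 0 < Lf + bmax + 1 by rewrite ltr_wpDl// addr_ge0.
have nk0 : 0 < nu * kappa by rewrite mulr_gt0.
have e10 : 0 < 1 - eta1 by rewrite subr_gt0 (lt_trans heta12).
have theta0 : 0 < theta by rewrite lt_min ltr01 divr_gt0// mulr_gt0.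
have x0 : x @ \oo --> (0 : R).
  apply: (@criticality_cvg0 R x Delta F acc (2 * tau^-1 + Lf)
    (eta1 * (nu * kappa)) theta gammac Flow).
  - by rewrite addr_ge0// mulr_ge0// invr_ge0 ltW.
  - by rewrite mulr_gt0.
  - exact: theta0.
  - exact: hgammac.
  - by move=> k; exact: ltW (x_gt0 k).
  - exact: D0.
  - by move=> k; have := hFlow _ (dw k);
      rewrite /objective -(dom_fineK phi_gt (dw k)) -EFinD lee_fin.
  - move=> k ak; rewrite /x; have [wk _] := acc_w k ak.
    apply: le_trans (chi_lip _ _ (dw _) (dw _)) _.
    rewrite wk (addrC (w k)) addrK; apply: ler_wpM2l (dD k).
    by rewrite addr_ge0// mulr_ge0// invr_ge0 ltW.
  - move=> k ak; have [wk _] := acc_w k ak.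
    have -> : F k.+1 = Fd k by rewrite /F wk.
    move: ak; rewrite /acc rhoE ler_pdivlMr//; apply: le_trans.
    by rewrite -!(mulrA eta1) ler_pM2l//; exact: PE.
  - by move=> k /acc_w[].
  - by move=> k /rej_w[wk _]; rewrite /x wk.
  - by move=> k /rej_w[wk _]; rewrite /F wk.
  - by move=> k /rej_w[].
  - move=> k small; rewrite /acc rhoE ler_pdivlMr//.
    apply: le_trans (model_error k).
    have Dx : Delta k <= x k.
      by apply: le_trans small _; rewrite ger_pMl// ge_min lexx.
    have := PE k; rewrite (min_idPr Dx) => Pk.
    have : (Lf + bmax) * Delta k ^+ 2 <= (1 - eta1) * P k; last by lra.
    apply: le_trans (_ : (1 - eta1) * (nu * kappa * x k * Delta k) <= _); last first.
      by rewrite ler_pM2l.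
    have th : Delta k * (Lf + bmax + 1) <= (1 - eta1) * (nu * kappa) * x k.
      rewrite -ler_pdivlMr// mulrAC; apply: le_trans small _.
      by rewrite ler_pM2r// ge_min lexx orbT.
    have -> : (1 - eta1) * (nu * kappa * x k * Delta k)
        = (1 - eta1) * (nu * kappa) * x k * Delta k by rewrite !mulrA.
    rewrite expr2 [leLHS]mulrA ler_pM2r//; apply: le_trans th.
    by rewrite mulrC ler_pM2l// lerDl.
have stat wbar : cluster (w k @[k --> \oo]) wbar -> stationary f phi wbar.
  rewrite cluster_cvgE => -[G PG [Gw wG]].
  apply: (prox_residual_limit_stationary hip f_diff phi_gt phi_closed hphi
    (p := p) htau PG Gw).
  - apply/cvgrPdist_lt => e e0; near=> u.
    apply: le_lt_trans (glip _ _) _.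
    apply: le_lt_trans (_ : (Lf + 1) * `|wbar - u| < _).
      by rewrite ler_wpM2r// lerDl.
    rewrite -ltr_pdivlMl ?ltr_wpDl//; near: u.
    apply: cvgr_dist_lt; first exact: cvg_id.
    by rewrite mulr_gt0// invr_gt0 ltr_wpDl.
  - by apply: wG; exists 0%N => // k _; exact: pE.
  - apply/cvgr0Pnorm_lt => e e0; apply: wG.
    have et : 0 < tau^-1 * e by rewrite mulr_gt0// invr_gt0.
    have [N _ hN] : \forall k \near \oo, `|x k| < tau^-1 * e.
      by move/cvgr0Pnorm_lt : x0; apply.
    exists N => // k /hN /=.
    by rewrite /x /chi normrM gtr0_norm ?invr_gt0// normr_id ltr_pM2l ?invr_gt0.
split=> // fin; split=> // bw.
have [wbar cw] := bounded_seq_cluster hip fin bw.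
by exists wbar => //; exact: stat.
Unshelve. all: by end_near. Qed.
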